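(* Let $(X,Y)$ and $(\tilde X,\tilde Y)$ be two random vectors with copulas $C_1$ and $C_2$, respectively. Suppose that $X=_{st}\tilde X$ and $Y=_{st}\tilde Y$, with cumulative distribution functions $F_X$ and $F_Y$, respectively. If $C_1\prec C_2$, then $$\mathsf{GMD}(X,Y)\ge \mathsf{GMD}(\tilde X,\tilde Y),\qquad \mathsf{G}(X,Y)\ge \mathsf{G}(\tilde X,\tilde Y).$$
   Context: Standing assumptions: all random variables are nonnegative with mean in $(0,\infty)$; components of a vector may be dependent. $=_{st}$ denotes equality in law. A copula of $(X,Y)$ is a copula $C$ with $\mathsf{Pr}(X\le x,Y\le y)=C(F_X(x),F_Y(y))$ for all $x,y$. $C_1\prec C_2$ (concordance order) means $C_1(u,v)\le C_2(u,v)$ for all $u,v\in[0,1]$. The bivariate Gini's mean difference is $\mathsf{GMD}(X,Y)=\mathsf{E}|X-Y|$, and the bivariate Gini's index is $\mathsf{G}(X,Y)=\mathsf{GMD}(X,Y)/(\mathsf{E}(X)+\mathsf{E}(Y))$. *)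

(* Defs.v *)
From HB Require Import structures.
From mathcomp Require Import all_boot all_order all_algebra.
From mathcomp Require Import all_classical all_reals all_analysis.
Import Order.TTheory GRing.Theory Num.Theory.
Import numFieldNormedType.Exports.

Set Implicit Arguments.
Unset Strict Implicit.
Unset Printing Implicit Defensive.

Local Open Scope classical_set_scope.
Local Open Scope ring_scope.

(* A bivariate copula, given as a total function R -> R -> R of which only the
   restriction to the unit square matters. The last field is the 2-increasing
   property; that C takes its values in [0, 1] follows from the three fields. *)
Record is_copula (R : realType) (C : R -> R -> R) : Prop := IsCopula {
  copula_grounded : forall u, 0 <= u <= 1 -> C u 0 = 0 /\ C 0 u = 0;
  copula_margins : forall u, 0 <= u <= 1 -> C u 1 = u /\ C 1 u = u;
  copula_2increasing : forall u1 u2 v1 v2,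
    0 <= u1 -> u1 <= u2 -> u2 <= 1 -> 0 <= v1 -> v1 <= v2 -> v2 <= 1 ->
    0 <= C u2 v2 - C u2 v1 - C u1 v2 + C u1 v1 }.

Definition concordance_le (R : realType) (C1 C2 : R -> R -> R) : Prop :=
  forall u v, 0 <= u <= 1 -> 0 <= v <= 1 -> C1 u v <= C2 u v.

Section Gini.
Context (R : realType) (d : measure_display) (T : measurableType d).
Variable P : probability T R.
Implicit Types X Y : {RV P >-> R}.
Local Open Scope ereal_scope.

(* cdf is extended-real valued in the library, but always lies in [0, 1]. *)
Definition copula_of X Y (C : R -> R -> R) : Prop :=
  is_copula C /\
  forall x y : R, P [set w | (X w <= x)%R /\ (Y w <= y)%R] =
                  (C (fine (cdf X x)) (fine (cdf Y y)))%:E.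

Definition admissible X : Prop :=
  {ae P, forall w, (0 <= X w)%R} /\ 0 < 'E_P[X] < +oo.

Definition GMD X Y : \bar R := 'E_P[fun w => `|X w - Y w|%R].

Definition gini X Y : \bar R := GMD X Y / ('E_P[X] + 'E_P[Y]).

End Gini.

(* Restricted to measurable sets: as functions on all sets of reals, the two
   distributions may differ on nonmeasurable ones even when the laws agree. *)
Definition eq_law (R : realType) (d1 d2 : measure_display)
    (T1 : measurableType d1) (T2 : measurableType d2)
    (P1 : probability T1 R) (P2 : probability T2 R)
    (X1 : {RV P1 >-> R}) (X2 : {RV P2 >-> R}) : Prop :=
  forall A : set R, measurable A -> distribution P1 X1 A = distribution P2 X2 A.

(* Main.v *)
Require Import Defs.
From HB Require Import structures.
From mathcomp Require Import all_boot all_order all_algebra.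
From mathcomp Require Import all_classical all_reals all_analysis.
From mathcomp Require Import measurable_realfun.
Import Order.TTheory GRing.Theory Num.Theory.
Import numFieldNormedType.Exports.

(** The distance between two reals is the length of the interval that separates
them, so |X - Y| is the Lebesgue measure of the levels t lying between X and Y,
i.e. those for which exactly one of X <= t and Y <= t holds. By Tonelli,
[[
   E|X - Y| = \int P(exactly one of X <= t, Y <= t) dt,
]]
([GMD_layer_cake]), and by inclusion-exclusion the integrand is
[F_X(t) + F_Y(t) - 2 C(F_X(t), F_Y(t))] ([prob_ysection_between]). The margins
being fixed, this decreases pointwise when the copula increases, hence so does
its integral; the integrands being nonnegative, the comparison takes place in
the extended reals.
The Gini index inherits the inequality because its denominator depends on the
margins only ([expectation_eq_law]). *)

Local Open Scope classical_set_scope.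
Local Open Scope ring_scope.

Section LayerCake.
Context {R : realType} {d : measure_display} {T : measurableType d}.
Variable P : probability T R.
Local Open Scope ereal_scope.

Definition epigraph (X : T -> R) : set (T * R) := [set p | (X p.1 <= p.2)%R].

(** The region between the two graphs, as a symmetric difference of epigraphs.
Its section over w is the half-open interval with endpoints X w and Y w, while
its section at level t is an event whose probability is determined by the
margins and the joint cdf at (t, t). *)
Definition between (X Y : T -> R) : set (T * R) :=
  (epigraph X `\` epigraph Y) `|` (epigraph Y `\` epigraph X).

Lemma measurable_epigraph (X : {RV P >-> R}) : measurable (epigraph X).
Proof.
have -> : epigraph X =
    setT `&` (fun p : T * R => p.2 - X p.1)%R @^-1` `[0%R, +oo[.
  by rewrite setTI; apply/seteqP; split => p /=; rewrite in_itv/= andbT subr_ge0.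
by apply: measurable_funB => //; exact: measurableT_comp.
Qed.

Lemma measurable_between (X Y : {RV P >-> R}) : measurable (between X Y).
Proof.
by apply: measurableU; apply: measurableD; exact: measurable_epigraph.
Qed.

(** This is where the symmetric difference pays off: whichever of X w and Y w is
smaller, one of the two pieces is empty and the other is an interval. *)
Lemma lebesgue_xsection_between (X Y : T -> R) (w : T) :
  lebesgue_measure (xsection (between X Y) w) = (`|X w - Y w|%R)%:E.
Proof.
have half (a b : R) : (a <= b)%R ->
    lebesgue_measure ([set t : R | (a <= t)%R /\ ~ (b <= t)%R] `|`
                      [set t : R | (b <= t)%R /\ ~ (a <= t)%R]) = (b - a)%:E.
  move=> ab; rewrite (_ : _ `|` _ = `[a, b[%classic); last first.
    apply/seteqP; split => t /=; rewrite in_itv/=.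
      move=> [[-> /negP]|[bt]]; first by rewrite -ltNge.
      by move=> []; exact: le_trans bt.
    by move=> /andP[-> tb]; left; split=> //; apply/negP; rewrite -ltNge.
  rewrite lebesgue_measure_itv/= lte_fin; case: ltP => // ba.
  by rewrite (le_anti (introT andP (conj ab ba))) subrr.
rewrite (_ : xsection _ _ = [set t : R | (X w <= t)%R /\ ~ (Y w <= t)%R] `|`
                      [set t : R | (Y w <= t)%R /\ ~ (X w <= t)%R]); last first.
  by apply/seteqP; split => t; rewrite /xsection/= inE.
have [XY|/ltW YX] := leP (X w) (Y w).
  by rewrite half// ler0_norm ?subr_le0// opprB.
by rewrite setUC half// ger0_norm// subr_ge0.
Qed.

(** Tonelli's theorem in its set form: the area of the region between the graphs
is computed by slicing it over the sample space or by levels. *)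
Lemma GMD_layer_cake (X Y : {RV P >-> R}) :
  GMD X Y = \int[lebesgue_measure]_t P (ysection (between X Y) t).
Proof.
rewrite /GMD unlock.
under eq_integral do rewrite -lebesgue_xsection_between.
rewrite -/(product_measure1 P lebesgue_measure (between X Y)).
(* The two ways of slicing agree because they agree on rectangles. *)
transitivity (product_measure2 P lebesgue_measure (between X Y)) => //.
apply: product_measure_unique; last exact: measurable_between.
by move=> A B mA mB /=; rewrite product_measure2E.
Qed.

(** At level t the region is the symmetric difference of the events X <= t and
Y <= t, whose intersection has probability C(F_X(t), F_Y(t)); hence only the
diagonal of the joint cdf enters the mean difference. *)
Lemma prob_ysection_between (X Y : {RV P >-> R}) (t : R) (C : R -> R -> R) :
  copula_of X Y C -> P (ysection (between X Y) t) =
  (fine (cdf X t) + fine (cdf Y t)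
    - C (fine (cdf X t)) (fine (cdf Y t)) *+ 2)%:E.
Proof.
move=> [_ /(_ t t)].
set A := X @^-1` `]-oo, t]; set B := Y @^-1` `]-oo, t].
have -> : [set w | (X w <= t)%R /\ (Y w <= t)%R] = A `&` B.
  by apply/seteqP; split => w; rewrite /A /B /= !in_itv.
move=> PAB.
have mA : measurable A by rewrite -[A]setTI; exact: measurable_funP.
have mB : measurable B by rewrite -[B]setTI; exact: measurable_funP.
have -> : ysection (between X Y) t = (A `\` B) `|` (B `\` A).
  by apply/seteqP; split => w; rewrite /ysection/= inE /A /B /= !in_itv.
rewrite measureU//; [|exact: measurableD..|]; last first.
  by apply/seteqP; split => w // -[[_ nB] []].
have Pfin D : measurable D -> P D < +oo.
  by move=> mD; rewrite -ge0_fin_numE// fin_num_measure.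
rewrite !measureD// ?Pfin// [B `&` A]setIC.
pose c := (C (fine (cdf X t)) (fine (cdf Y t)))%:E.
transitivity ((cdf X t - c) + (cdf Y t - c)); first by rewrite /c -PAB.
have cdfE (Z : {RV P >-> R}) : cdf Z t = (fine (cdf Z t))%:E.
  by rewrite fineK// fin_num_measure.
rewrite [in LHS](cdfE X) [in LHS](cdfE Y) /c.
by rewrite -!EFinB -EFinD mulr2n opprD addrACA.
Qed.

End LayerCake.

(** The change of variables is applied to the positive and negative parts
separately, since the extended-real expectation is their difference and each
part is a nonnegative function of the variable. *)
Lemma expectation_eq_law {R : realType} {d1 d2 : measure_display}
    {T1 : measurableType d1} {T2 : measurableType d2}
    {P1 : probability T1 R} {P2 : probability T2 R}
    (X : {RV P1 >-> R}) (X' : {RV P2 >-> R}) :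
  eq_law X X' -> ('E_P1[X] = 'E_P2[X'])%E.
Proof.
move=> XX'.
have ge0E (f : R -> \bar R) : measurable_fun setT f -> (forall x, 0 <= f x)%E ->
    (\int[P1]_w f (X w) = \int[P2]_w f (X' w))%E.
  move=> mf f0; rewrite -(ge0_integral_distribution X)//.
  rewrite -(ge0_integral_distribution X')//.
  by apply: eq_measure_integral => A mA _; exact: XX'.
rewrite unlock integralE [RHS]integralE; congr (_ - _)%E.
  rewrite (funepos_comp EFin X) (funepos_comp EFin X').
  by apply: (ge0E (EFin^\+)%E) => //; exact: measurable_funepos.
rewrite (funeneg_comp EFin X) (funeneg_comp EFin X').
by apply: (ge0E (EFin^\-)%E) => //; exact: measurable_funeneg.
Qed.

Theorem proposition3p2 (R : realType) (d1 d2 : measure_display)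
    (T1 : measurableType d1) (T2 : measurableType d2)
    (P1 : probability T1 R) (P2 : probability T2 R)
    (X Y : {RV P1 >-> R}) (X' Y' : {RV P2 >-> R}) (C1 C2 : R -> R -> R)
    (hX : admissible X) (hY : admissible Y)
    (hX' : admissible X') (hY' : admissible Y')
    (hC1 : copula_of X Y C1) (hC2 : copula_of X' Y' C2)
    (eqX : eq_law X X') (eqY : eq_law Y Y')
    (hC : concordance_le C1 C2) :
  (GMD X Y >= GMD X' Y')%E /\ (gini X Y >= gini X' Y')%E.
Proof.
have le_GMD : (GMD X' Y' <= GMD X Y)%E.
  rewrite !GMD_layer_cake; apply: ge0_le_integral => //.
  - exact: (measurable_fun_ysection P2 (measurable_between P2 X' Y')).
  - exact: (measurable_fun_ysection P1 (measurable_between P1 X Y)).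
  move=> t _; rewrite (prob_ysection_between _ _ _ _ _ hC1).
  rewrite (prob_ysection_between _ _ _ _ _ hC2).
  have -> : cdf X' t = cdf X t by rewrite /cdf eqX.
  have -> : cdf Y' t = cdf Y t by rewrite /cdf eqY.
  have fine01 (Z : {RV P1 >-> R}) : 0 <= fine (cdf Z t) <= 1.
    rewrite fine_ge0//=.
    by rewrite -[leRHS]/(fine 1%E) fine_le ?fin_num_measure// cdf_le1.
  by rewrite lee_fin lerD2l lerN2 lerMn2r hC.
split=> //; rewrite /gini.
rewrite (expectation_eq_law _ _ eqX) (expectation_eq_law _ _ eqY).
rewrite lee_wpmul2r// inve_ge0.
by case: hX' => _ /andP[/ltW ? _]; case: hY' => _ /andP[/ltW ? _]; exact: adde_ge0.
Qed.
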